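(* Let $\omega=(i_1\ldots i_s)\in\Omega$ be a word. The variety $\mathcal{E}_\omega$ consists of all representations of $Q$ of dimension vector $|\omega|$ which are conjugate (under $G_{|\omega|}$) to a representation $X=(X_\alpha)_\alpha\in R_{|\omega|}$ satisfying the following: for all arrows $\alpha$ of $Q$ and all $1\le k<l\le s$ such that $i_k=h\alpha$ is the head of $\alpha$ and $i_l=t\alpha$ is the tail of $\alpha$, the matrix entry in row $v(k)$ and column $v(l)$ of $X_\alpha$ vanishes: $$(X_\alpha)_{v(k),v(l)}=0.$$
   Context: The ground field (denoted $K$ here, to distinguish it from the index $k$) is algebraically closed of characteristic $0$, and $Q$ is a finite quiver without oriented cycles with vertex set $I$; $t\alpha$ and $h\alpha$ denote the tail and head of an arrow $\alpha$. $\mathbf{N}I$ is the set of vectors with nonnegative integer coordinates in the free abelian group on symbols $\sigma_i$ ($i\in I$). For $d\in\mathbf{N}I$, $R_d=\bigoplus_{\alpha:i\to j}\mathrm{Hom}_K(K^{d_i},K^{d_j})$ is the variety of representations of $Q$ of dimension vector $d$, acted on by $G_d=\prod_{i\in I}\mathrm{GL}_{d_i}(K)$ via $(g_i)_i(M_\alpha)_\alpha=(g_{h\alpha}M_\alpha g_{t\alpha}^{-1})_\alpha$; thus $M_\alpha$ is a $d_{h\alpha}\times d_{t\alpha}$ matrix. For $\mathcal{A}\subset R_d$, $\mathcal{B}\subset R_e$, the set $\mathcal{A}*\mathcal{B}\subset R_{d+e}$ consists of all $X\in R_{d+e}$ for which there is an exact sequence of representations $0\to N\to X\to M\to 0$ with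 $M\in\mathcal{A}$, $N\in\mathcal{B}$; this operation is associative. $\Omega$ is the set of finite words in the alphabet $I$, and for $\omega=(i_1\ldots i_s)$ we put $|\omega|=\sigma_{i_1}+\cdots+\sigma_{i_s}$ and $\mathcal{E}_\omega:=R_{\sigma_{i_1}}*\cdots*R_{\sigma_{i_s}}\subset R_{|\omega|}$ (where $R_{\sigma_i}$ is a single point, the simple representation $E_i$ at the vertex $i$). For the given word $\omega=(i_1\ldots i_s)$, the function $v:\{1,\ldots,s\}\to\mathbf{N}$ is defined by: $v(k)=1$ if $i_l\ne i_k$ for all $l>k$; and $v(k)=v(l)+1$ if $l>k$, $i_l=i_k$ and $i_p\ne i_k$ for all $k<p<l$. (So $v(k)$ says that the letter $i_k$ at position $k$ appears there for the $v(k)$-th time when $\omega$ is read from right to left.) *)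

(* Defs.v *)
From HB Require Import structures.
From mathcomp Require Import all_boot all_order all_algebra.
Set Implicit Arguments.
Unset Strict Implicit.
Unset Printing Implicit Defensive.
Import GRing.Theory.
Local Open Scope ring_scope.

Record quiver := Quiver {
  vertex : finType;
  arrow : finType;
  tl : arrow -> vertex;
  hd : arrow -> vertex
}.

(* [cycle] closes the path up, so the one-arrow sequence [:: a] covers loops. *)
Definition acyclic (Q : quiver) : Prop :=
  forall p : seq (arrow Q),
    p != [::] -> ~~ cycle (fun a b => hd a == tl b) p.

Definition dimvec (Q : quiver) := vertex Q -> nat.

Definition dim0 (Q : quiver) : dimvec Q := fun _ => 0%N.
Definition dim_add (Q : quiver) (d e : dimvec Q) : dimvec Q :=
  fun i => (d i + e i)%N.
Definition sigma (Q : quiver) (i : vertex Q) : dimvec Q :=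
  fun j => (i == j : nat).

(* Matrices act on column vectors. *)
Definition rep (K : fieldType) (Q : quiver) (d : dimvec Q) :=
  forall a : arrow Q, 'M[K]_(d (hd a), d (tl a)).

Definition conjugate (K : fieldType) (Q : quiver) (d : dimvec Q)
    (Y X : rep K d) : Prop :=
  exists g : forall i : vertex Q, 'M[K]_(d i),
    (forall i, g i \in unitmx) /\
    (forall a, Y a = g (hd a) *m X a *m invmx (g (tl a))).

Definition is_rep_hom (K : fieldType) (Q : quiver) (d e : dimvec Q)
    (M : rep K d) (N : rep K e) (f : forall i, 'M[K]_(e i, d i)) : Prop :=
  forall a, f (hd a) *m M a = N a *m f (tl a).

(* There is an exact sequence 0 -> N -> X -> M -> 0. *)
Definition has_ses (K : fieldType) (Q : quiver) (e x d : dimvec Q)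
    (N : rep K e) (X : rep K x) (M : rep K d) : Prop :=
  exists (f : forall i, 'M[K]_(x i, e i)) (g : forall i, 'M[K]_(d i, x i)),
    [/\ is_rep_hom N X f,
        is_rep_hom X M g,
        forall i, injective (fun u : 'cV[K]_(e i) => f i *m u),
        forall i (w : 'cV[K]_(d i)), exists u : 'cV[K]_(x i), g i *m u = w &
        forall i (u : 'cV[K]_(x i)),
          g i *m u = 0 <-> exists z : 'cV[K]_(e i), f i *m z = u].

Definition star (K : fieldType) (Q : quiver) (d e : dimvec Q)
    (A : rep K d -> Prop) (B : rep K e -> Prop) (X : rep K (dim_add d e)) :
    Prop :=
  exists (M : rep K d) (N : rep K e), [/\ A M, B N & has_ses N X M].

Definition word_dim (Q : quiver) (w : seq (vertex Q)) : dimvec Q :=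
  foldr (fun i d => dim_add (sigma i) d) (@dim0 Q) w.

(* The iterated product is bracketed to the right and starts from the one-point
   variety R_0, which is neutral for [star]; the set R_(sigma i) is all of
   [rep K (sigma i)], a single point because there are no loops. *)
Fixpoint Eword (K : fieldType) (Q : quiver) (w : seq (vertex Q)) :
    rep K (word_dim w) -> Prop :=
  match w return rep K (word_dim w) -> Prop with
  | [::] => fun _ => True
  | i :: w' => star (fun _ : rep K (sigma i) => True) (@Eword K Q w')
  end.

(* The values are 1-based, the positions [k] 0-based. If the letter at position
   0 of [i :: w'] recurs, its next occurrence is at position [index i w'] of
   [w']. The value 0 at positions past the end is junk. *)
Fixpoint occ (T : eqType) (w : seq T) (k : nat) : nat :=
  match w, k with
  | [::], _ => 0
  | i :: w', 0 => if i \in w' then (occ w' (index i w')).+1 else 1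
  | _ :: w', k'.+1 => occ w' k'
  end.

Lemma occ_last (T : eqType) (x0 : T) (w : seq T) (k : nat) :
  (k < size w)%N ->
  (forall l, (k < l < size w)%N -> nth x0 w l != nth x0 w k) ->
  occ w k = 1%N.
Proof.
elim: w k => [|i w IH] [|k] //= kw H.
  case: ifP => // iw; have := H (index i w).+1.
  by rewrite /= ltnS index_mem iw nth_index // eqxx => /(_ isT).
by apply: IH => // l Hl; apply: (H l.+1).
Qed.

Lemma occ_next (T : eqType) (x0 : T) (w : seq T) (k l : nat) :
  (k < l < size w)%N -> nth x0 w l = nth x0 w k ->
  (forall p, (k < p < l)%N -> nth x0 w p != nth x0 w k) ->
  occ w k = (occ w l).+1.
Proof.
elim: w k l => [|i w IH] [|k] [|l] //=; rewrite ?andbF // ltnS => Hl El H.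
  have iw : i \in w by rewrite -El mem_nth.
  rewrite iw; congr (occ w _).+1; apply/eqP; rewrite eqn_leq.
  have le_il : (index i w <= l)%N by rewrite -[i in index i]El index_nth.
  rewrite le_il /= leqNgt; apply/negP => lt_il.
  by have := H (index i w).+1 lt_il; rewrite /= nth_index // eqxx.
by apply: IH => // p Hp; apply: (H p.+1).
Qed.

Lemma occ_range (Q : quiver) (w : seq (vertex Q)) (k : 'I_(size w)) :
  (0 < occ w k <= word_dim w (tnth (in_tuple w) k))%N.
Proof.
rewrite (tnth_nth (tnth (in_tuple w) k)) /=.
set x0 := tnth _ _; move: x0 (nat_of_ord k) (ltn_ord k) => {k} x0 k.
elim: w k => [|i w IH] [|k] //= kw; rewrite /dim_add /sigma.
  rewrite eqxx; case: ifP => iw //.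
  have := IH (index i w); rewrite index_mem nth_index // => /(_ iw) /andP[_].
  by rewrite add1n.
by have /andP[-> /= /leq_trans -> //] := IH k kw; rewrite leq_addl.
Qed.

(* Row and column numbers are 0-based in MathComp, hence the successors on [p]
   and [q]; by [occ_range], such [p] and [q] exist (uniquely) for all [k], [l]. *)
Definition vanishing (K : fieldType) (Q : quiver) (w : seq (vertex Q))
    (X : rep K (word_dim w)) : Prop :=
  forall (a : arrow Q) (k l : 'I_(size w)),
    (k < l)%N -> tnth (in_tuple w) k = hd a -> tnth (in_tuple w) l = tl a ->
  forall (p : 'I_(word_dim w (hd a))) (q : 'I_(word_dim w (tl a))),
    p.+1 = occ w k -> q.+1 = occ w l -> X a p q = 0.

(* Main.v *)
Require Import Defs.
From mathcomp Require Import all_boot all_order all_algebra.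
Set Implicit Arguments.
Unset Strict Implicit.
Unset Printing Implicit Defensive.
Import GRing.Theory.
Local Open Scope ring_scope.

(** The proof is an induction on the word. Let [w = i :: w'], and write [d] and
    [d'] for the dimension vectors of [w] and [w']. The first letter of [w] is
    the last occurrence of [i] when reading from the right, so it labels the
    last basis vector at the vertex [i], while the letters of [w'] label the
    first [d' j] basis vectors at every vertex [j]. Since every row or column
    number is labelled by exactly one letter, the vanishing conditions for [w]
    say that the coordinate subspaces spanned by these first [d' j] vectors
    form a subrepresentation of [X], and that this subrepresentation satisfies
    the vanishing conditions for [w'] ([vanishing_cons]).

    On the other side, [Y] lies in [E_w] if and only if it has a
    subrepresentation of dimension vector [d'] isomorphic to a member of
    [E_w'], because a quotient of [Y] by it always exists and the simple [E_i]
    is the only representation of its dimension vector ([injective_hom_ses]).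

    A change of basis turns any injective family of matrices into the family of
    coordinate inclusions ([complete_to_unitmx]), which matches the two
    descriptions. *)

(** * Splitting the last coordinates off *)

(* The equation [e : n + s = m] is kept abstract: [n] counts the coordinates
   of the subspace, which have to come first, whereas the dimension vector of
   an extension is written with the quotient first. *)
Section Split.

Variables (K : fieldType) (n s m : nat) (e : (n + s = m)%N).

Definition first_ord (q : 'I_n) : 'I_m := cast_ord e (lshift s q).
Definition last_ord (q : 'I_s) : 'I_m := cast_ord e (rshift n q).

Definition incl_mx : 'M[K]_(m, n) := castmx (e, erefl n) (col_mx 1%:M 0).
Definition retr_mx : 'M[K]_(n, m) := castmx (erefl n, e) (row_mx 1%:M 0).
Definition sect_mx : 'M[K]_(m, s) := castmx (e, erefl s) (col_mx 0 1%:M).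
Definition proj_mx : 'M[K]_(s, m) := castmx (erefl s, e) (row_mx 0 1%:M).

End Split.

Section SplitTheory.

Variables (K : fieldType) (n s m : nat) (e : (n + s = m)%N).

Lemma retr_incl : retr_mx K e *m incl_mx K e = 1%:M.
Proof.
rewrite /incl_mx /retr_mx /sect_mx /proj_mx; case: m / e.
by rewrite !castmx_id mul_row_col mulmx1 mulmx0 addr0.
Qed.

Lemma proj_incl : proj_mx K e *m incl_mx K e = 0.
Proof.
rewrite /incl_mx /retr_mx /sect_mx /proj_mx; case: m / e.
by rewrite !castmx_id mul_row_col mulmx1 mulmx0 addr0.
Qed.

Lemma proj_sect : proj_mx K e *m sect_mx K e = 1%:M.
Proof.
rewrite /incl_mx /retr_mx /sect_mx /proj_mx; case: m / e.
by rewrite !castmx_id mul_row_col mulmx1 mulmx0 add0r.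
Qed.

Lemma incl_retr_sect_proj :
  incl_mx K e *m retr_mx K e + sect_mx K e *m proj_mx K e = 1%:M.
Proof.
rewrite /incl_mx /retr_mx /sect_mx /proj_mx; case: m / e.
rewrite !castmx_id !mul_col_row !mulmx1 !mulmx0.
by rewrite add_block_mx !addr0 !add0r -scalar_mx_block.
Qed.

Lemma retr_mulE p (A : 'M[K]_(m, p)) x y :
  (retr_mx K e *m A) x y = A (first_ord e x) y.
Proof.
rewrite /first_ord /incl_mx /retr_mx; case: m / e A => A.
rewrite castmx_id cast_ord_id.
by rewrite -{1}[A]vsubmxK mul_row_col mul1mx mul0mx addr0 mxE.
Qed.

Lemma proj_mulE p (A : 'M[K]_(m, p)) x y :
  (proj_mx K e *m A) x y = A (last_ord e x) y.
Proof.
rewrite /last_ord /proj_mx; case: m / e A => A.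
rewrite castmx_id cast_ord_id.
by rewrite -{1}[A]vsubmxK mul_row_col mul1mx mul0mx add0r mxE.
Qed.

Lemma mul_inclE p (A : 'M[K]_(p, m)) x y :
  (A *m incl_mx K e) x y = A x (first_ord e y).
Proof.
rewrite /first_ord /incl_mx /retr_mx; case: m / e A => A.
rewrite castmx_id cast_ord_id.
by rewrite -{1}[A]hsubmxK mul_row_col mulmx1 mulmx0 addr0 mxE.
Qed.

Lemma injective_row_free (f : 'M[K]_(m, n)) :
  injective (fun u : 'cV[K]_n => f *m u) -> row_free f^T.
Proof.
move=> injf; rewrite -kermx_eq0; apply/rowV0P => u /sub_kermxP uf0.
apply: trmx_inj; apply: injf.
by rewrite /= trmx0 mulmx0 -[f]trmxK -trmx_mul uf0 trmx0.
Qed.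

(** Any linearly independent family of [n] vectors consists of the images of
    the first [n] coordinate vectors under an invertible matrix. *)
Lemma complete_to_unitmx (f : 'M[K]_(m, n)) :
  injective (fun u : 'cV[K]_n => f *m u) ->
  {g : 'M[K]_m | g \in unitmx & g *m incl_mx K e = f}.
Proof.
move=> /injective_row_free freef.
pose U := (incl_mx K e)^T; pose F := (retr_mx K e)^T *m f^T.
have UF : U *m F = f^T by rewrite mulmxA -trmx_mul retr_incl trmx1 mul1mx.
have rankU : \rank U = n.
  apply/eqP/row_freeP; exists (retr_mx K e)^T.
  by rewrite -trmx_mul retr_incl trmx1.
have rankUF : \rank (U *m F) = \rank U by rewrite UF rankU; apply/eqP.
have [g gU Eg] := complete_unitmx rankUF.
exists g^T; first by rewrite unitmx_tr.
by apply: trmx_inj; rewrite trmx_mul trmxK -Eg.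
Qed.

End SplitTheory.

(** * Subrepresentations *)

Section Subrepresentations.

Variables (K : fieldType) (Q : quiver).

Definition incl_rep (d e : dimvec Q) (i : vertex Q) :
  'M[K]_(dim_add d e i, e i) := incl_mx K (addnC (e i) (d i)).

Lemma incl_rep_inj (d e : dimvec Q) i :
  injective (fun u : 'cV[K]_(e i) => incl_rep d e i *m u).
Proof.
move=> u v /(congr1 (mulmx (retr_mx K (addnC (e i) (d i))))).
by rewrite /= !mulmxA retr_incl !mul1mx.
Qed.

(** The cokernel of an injective homomorphism is a representation: in a basis
    adapted to the image, it acts by the lower right blocks. *)
Lemma injective_hom_ses (d e : dimvec Q) (N : rep K e)
    (X : rep K (dim_add d e)) (f : forall i, 'M[K]_(dim_add d e i, e i)) :
  is_rep_hom N X f ->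
  (forall i, injective (fun u : 'cV[K]_(e i) => f i *m u)) ->
  exists M : rep K d, has_ses N X M.
Proof.
move=> homf injf.
pose E i := addnC (e i) (d i).
pose G i := s2val (complete_to_unitmx (E i) (injf i)).
have GU i : G i \in unitmx := s2valP (complete_to_unitmx (E i) (injf i)).
have GE i : G i *m incl_mx K (E i) = f i.
  exact: s2valP' (complete_to_unitmx (E i) (injf i)).
pose g i := proj_mx K (E i) *m invmx (G i).
have gf i : g i *m f i = 0.
  by rewrite -GE mulmxA mulmxKV // proj_incl.
have gs i : g i *m (G i *m sect_mx K (E i)) = 1%:M.
  by rewrite mulmxA mulmxKV // proj_sect.
have fgE i : f i *m (retr_mx K (E i) *m invmx (G i))
    + G i *m sect_mx K (E i) *m g i = 1%:M.
  rewrite -GE /g !mulmxA -mulmxDl -!(mulmxA (G i)) -mulmxDr.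
  by rewrite incl_retr_sect_proj mulmx1 mulmxV ?GU.
pose M : rep K d := fun a =>
  g (hd a) *m X a *m (G (tl a) *m sect_mx K (E (tl a))).
exists M, f, g; split=> // [a|i w|i u].
- (* the part of [X a] along the image of [f] stays in it, so [g] kills it *)
  rewrite -[LHS]mulmx1 -(fgE (tl a)) mulmxDr !mulmxA.
  by rewrite -(mulmxA (g _)) -homf !mulmxA gf !mul0mx add0r.
- by exists (G i *m sect_mx K (E i) *m w); rewrite mulmxA gs mul1mx.
split=> [gu0 | [z <-]]; last by rewrite mulmxA gf mul0mx.
exists (retr_mx K (E i) *m invmx (G i) *m u).
rewrite -[RHS]mul1mx -(fgE i) mulmxDl -(mulmxA _ (g i)) gu0 mulmx0 addr0.
by rewrite !mulmxA.
Qed.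

Lemma conjugate_refl (d : dimvec Q) (X : rep K d) : conjugate X X.
Proof.
exists (fun=> 1%:M); split=> [i|a]; first exact: unitmx1.
by rewrite invmx1 mul1mx mulmx1.
Qed.

End Subrepresentations.

(** * Occurrences of letters *)

Section Occurrences.

Variable Q : quiver.
Implicit Types (w : seq (vertex Q)) (i j : vertex Q).

Lemma word_dimE w j : word_dim w j = count_mem j w.
Proof. by elim: w => //= i w <-. Qed.

Lemma occ_index w i : i \in w -> occ w (index i w) = word_dim w i.
Proof.
elim: w => //= j w IH; rewrite inE /dim_add /sigma eq_sym.
have [-> _|_ /=] := eqVneq j i; last exact: IH.
have [iw|iw] := ifPn; first by rewrite IH.
by rewrite word_dimE (count_memPn iw).
Qed.

Lemma occ_head i w : occ (i :: w) 0 = (word_dim w i).+1.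
Proof.
rewrite /=; case: ifPn => [/occ_index->|iw] //.
by rewrite word_dimE (count_memPn iw).
Qed.

(** The letter of [i :: w] at position 0 takes the number that comes right after
    those of the letters [i] of [w]; so no number is skipped. *)
Lemma occ_surj x0 w j q : (q < word_dim w j)%N ->
  exists l, [/\ (l < size w)%N, nth x0 w l = j & occ w l = q.+1].
Proof.
elim: w => //= i w IH; have [/IH[l [lw lj lq]] _|le_q] := ltnP q (word_dim w j).
  by exists l.+1.
rewrite /dim_add /sigma; have [eq_ij|_] := eqVneq i j.
  rewrite -eq_ij in le_q *; rewrite add1n ltnS => ge_q; exists 0%N; split=> //.
  rewrite -/(occ (i :: w) 0) occ_head; congr _.+1.
  by apply/eqP; rewrite eqn_leq le_q.
by rewrite add0n ltnNge le_q.
Qed.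

End Occurrences.

(** * The vanishing conditions *)

Section Vanishing.

Variables (K : fieldType) (Q : quiver).

(** Positions as natural numbers are compatible with passing from [w] to
   [i :: w], which the dependent type of positions in [vanishing] obscures. *)
Lemma vanishingP (x0 : vertex Q) (w : seq (vertex Q)) (X : rep K (word_dim w)) :
  vanishing X <->
  forall a k l, (k < l < size w)%N -> nth x0 w k = hd a -> nth x0 w l = tl a ->
  forall p q, (nat_of_ord p).+1 = occ w k -> (nat_of_ord q).+1 = occ w l ->
  X a p q = 0.
Proof.
split=> H a k l.
  move=> /andP[kl lw] hk hl p q; have kw := ltn_trans kl lw.
  by apply: (H a (Ordinal kw) (Ordinal lw)); rewrite ?(tnth_nth x0).
by rewrite !(tnth_nth x0) => kl hk hl p q; apply: H; rewrite ?kl ?ltn_ord.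
Qed.

(** The conditions at position 0 say that the last coordinate at the vertex [i]
    of the image of the coordinate subspaces is zero, that is, that these
    subspaces are stable; the conditions at positive positions are those of
    [w] for the restriction. *)
Lemma vanishing_cons (i : vertex Q) (w : seq (vertex Q))
    (X : rep K (word_dim (i :: w))) :
  vanishing X <->
  exists X' : rep K (word_dim w),
    vanishing X' /\ is_rep_hom X' X (incl_rep K (sigma i) (word_dim w)).
Proof.
pose E j := addnC (word_dim w j) (sigma i j).
split=> [/(vanishingP i) vanX|[X' [/(vanishingP i) vanX' homX']]].
  pose X' : rep K (word_dim w) := fun a =>
    retr_mx K (E (hd a)) *m (X a *m incl_mx K (E (tl a))).
  exists X'; split=> [|a].
    apply/(vanishingP i) => a k l kl hk hl p q pk ql.
    by rewrite /X' retr_mulE mul_inclE; apply: (vanX a k.+1 l.+1).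
  rewrite /incl_rep /X' -/E.
  have proj0 : proj_mx K (E (hd a)) *m (X a *m incl_mx K (E (tl a))) = 0.
    apply/matrixP => p q; rewrite proj_mulE mul_inclE [RHS]mxE.
    have [l [lw lt lq]] := occ_surj i (ltn_ord q).
    (* a row index [p] exists only when the head of [a] is [i] *)
    have [i_hd p0] : i = hd a /\ p = 0%N :> nat.
      have := ltn_ord p; rewrite {2}/sigma; case: eqP => //= i_hd.
      by rewrite ltnS leqn0 => /eqP.
    apply: (vanX a 0%N l.+1) => //.
    by rewrite occ_head /= p0 addn0 i_hd.
  rewrite -[RHS]mul1mx -(incl_retr_sect_proj K (E (hd a))) mulmxDl.
  by rewrite -[X in _ = _ + X]mulmxA proj0 mulmx0 addr0 mulmxA.
apply/(vanishingP i) => a k [|l]; rewrite ?ltn0 // => kl hk hl p q pk ql.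
have lw : (l < size w)%N by case/andP: kl.
have q_lt : (q < word_dim w (tl a))%N.
  have := occ_range (Ordinal lw).
  by rewrite (tnth_nth i) /= [nth _ _ _]hl -[occ w l]ql.
have -> : q = first_ord (E (tl a)) (Ordinal q_lt) by apply: val_inj.
rewrite -mul_inclE -/(incl_rep K _ _ _) -homX' /incl_rep -/E.
case: k kl hk pk => [|k] kl hk pk.
  rewrite occ_head in pk; case: pk => pk; rewrite /= in hk.
  have s1 : (0 < sigma i (hd a))%N by rewrite /sigma hk eqxx.
  have -> : p = last_ord (E (hd a)) (Ordinal s1).
    by apply: val_inj; rewrite /= addn0 pk hk.
  by rewrite -proj_mulE mulmxA proj_incl mul0mx mxE.
have kw : (k < size w)%N by case/andP: kl => /ltn_trans; apply.
have p_lt : (p < word_dim w (hd a))%N.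
  have := occ_range (Ordinal kw).
  by rewrite (tnth_nth i) /= [nth _ _ _]hk -[occ w k]pk.
have -> : p = first_ord (E (hd a)) (Ordinal p_lt) by apply: val_inj.
by rewrite -retr_mulE mulmxA retr_incl mul1mx; apply: (vanX' a k l).
Qed.

End Vanishing.

(** * Iterated extensions of simple representations *)

Theorem lemma3p4 (K : closedFieldType) (charK : [pchar K] =i pred0)
    (Q : quiver) (acyclicQ : acyclic Q) (w : seq (vertex Q))
    (Y : rep K (word_dim w)) :
  Eword Y <-> exists X : rep K (word_dim w), conjugate Y X /\ vanishing X.
Proof.
elim: w Y => [|i w IH] Y.
  split=> // _; exists Y; split; first exact: conjugate_refl.
  by move=> a [].
split.
  case=> M [N [_ /IH[N' [[h [hU Nh]] vanN']] [f [g [homf _ injf _ _]]]]].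
  pose f' j := f j *m h j.
  have injf' j : injective (fun u : 'cV[K]_(word_dim w j) => f' j *m u).
    move=> u v; rewrite /= -!mulmxA => /injf.
    by move=> /(congr1 (mulmx (invmx (h j)))); rewrite !mulKmx.
  have homf' : is_rep_hom N' Y f'.
    by move=> a; rewrite /f' mulmxA -homf Nh -!mulmxA mulVmx ?mulmx1.
  pose E j := addnC (word_dim w j) (sigma i j).
  pose G j := s2val (complete_to_unitmx (E j) (injf' j)).
  have GU j : G j \in unitmx := s2valP (complete_to_unitmx (E j) (injf' j)).
  have GE j : G j *m incl_rep K (sigma i) (word_dim w) j = f' j.
    exact: s2valP' (complete_to_unitmx (E j) (injf' j)).
  (* in the basis given by [G], the image of [f'] is the coordinate subspace *)
  exists (fun a => invmx (G (hd a)) *m Y a *m G (tl a)); split.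
    exists G; split=> // a.
    by rewrite -(mulmxA (invmx _)) mulKVmx ?GU // mulmxK ?GU.
  apply/vanishing_cons; exists N'; split=> // a.
  by rewrite -!mulmxA GE -homf' -GE -mulmxA mulKmx ?GU.
case=> X [[g [gU Yg]] /vanishing_cons[X' [vanX' homX']]].
pose f j := g j *m incl_rep K (sigma i) (word_dim w) j.
have homf : is_rep_hom X' Y f.
  by move=> a; rewrite /f -mulmxA homX' Yg !mulmxA mulmxKV.
have injf j : injective (fun u : 'cV[K]_(word_dim w j) => f j *m u).
  move=> u v; rewrite /= -!mulmxA => /(congr1 (mulmx (invmx (g j)))).
  by rewrite !mulKmx // => /incl_rep_inj.
have [M ses] := injective_hom_ses homf injf.
exists M, X'; split=> //; apply/IH.
by exists X'; split=> //; apply: conjugate_refl.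
Qed.
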